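(* Let $n\in\mathbb{N}\setminus\{1,2\}$. Then: (a) The set $\mathcal{F}(\mathcal{O}_n)$ is successively determined by two $X$-rays in $\mathcal{O}_n$-directions. (b) The set $\mathcal{F}(\mathcal{O}_n)$ is successively determined by two projections on orthogonal complements of $1$-dimensional $\mathcal{O}_n$-subspaces.
   Context: Identify $\mathbb{C}$ with $\mathbb{R}^2$. Let $\zeta_n=e^{2\pi i/n}$ and $\mathcal{O}_n=\mathbb{Z}[\zeta_n]$. $\mathcal{F}(S)$ denotes the set of all finite subsets of $S\subset\mathbb{R}^2$. A direction is an element of $\mathbb{S}^1$; an $\mathcal{O}_n$-direction is a direction parallel to a non-zero element of $\mathcal{O}_n$; a $1$-dimensional $\mathcal{O}_n$-subspace is a line $\mathbb{R}o$ with $o\in\mathcal{O}_n\setminus\{0\}$. For a finite $F\subset\mathbb{R}^2$ and a direction $u$, the $X$-ray $X_uF$ is the function assigning to each line $\ell$ parallel to $u$ the number $\operatorname{card}(F\cap\ell)$. $F|T^\perp$ denotes the orthogonal projection (canonical inner product) of $F$ on $T^\perp$. A collection $\mathcal{E}$ of finite subsets of $\mathbb{R}^2$ is successively determined by $m$ $X$-rays in $\mathcal{O}_n$-directions if, for a given $F\in\mathcal{E}$, pairwise non-parallel $\mathcal{O}_n$-directions $u_1,\dots,u_m$ can be chosen inductively (the choice of $u_j$ depending on the $X$-rays $X_{u_k}F$, $k\in\{1,\dots,j-1\}$) such that for all $F'\in\mathcal{E}$: $(X_{u_j}F'=X_{u_j}F\ \forall j\in\{1,\dots,m\})\Rightarrow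 F'=F$. It is successively determined by $m$ projections on orthogonal complements of $1$-dimensional $\mathcal{O}_n$-subspaces if, for a given $F\in\mathcal{E}$, pairwise non-parallel $1$-dimensional $\mathcal{O}_n$-subspaces $T_1,\dots,T_m$ can be chosen inductively (the choice of $T_j$ depending on the projections $F|T_k^\perp$, $k\in\{1,\dots,j-1\}$) such that for all $F'\in\mathcal{E}$: $(F'|T_j^\perp=F|T_j^\perp\ \forall j\in\{1,\dots,m\})\Rightarrow F'=F$. *)

(* Defs.v *)
(* The plane R^2 is represented by C = R[i], through z |-> (Re z, Im z). *)
From HB Require Import structures.
From mathcomp Require Import all_boot all_order all_algebra finmap.
From mathcomp Require Import all_classical all_reals all_analysis.
From mathcomp Require Import complex.

Set Implicit Arguments.
Unset Strict Implicit.
Unset Printing Implicit Defensive.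

Import Order.TTheory GRing.Theory Num.Theory.
Import numFieldNormedType.Exports.

Local Open Scope classical_set_scope.
Local Open Scope fset_scope.
Local Open Scope complex_scope.
Local Open Scope ring_scope.

Section Plane.
Variable R : realType.
Local Notation C := R[i].

(* e^(2 pi i / n), in Cartesian form. *)
Definition zeta (n : nat) : C :=
  cos (2 * pi / n%:R) +i* sin (2 * pi / n%:R).

Definition cyclotomic_ring (n : nat) : set C :=
  [set z | exists p : {poly int}, z = (map_poly intr p).[zeta n]].

Definition finite_subsets (S : set C) : set {fset C} :=
  [set F : {fset C} | forall x, x \in F -> S x].

Definition inner (x y : C) : R :=
  complex.Re x * complex.Re y + complex.Im x * complex.Im y.

(* Parallelism of non-zero vectors. *)
Definition parallel (u v : C) : Prop :=
  exists2 t : R, t != 0 & u = t%:C * v.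

Definition direction (u : C) : Prop := `|u| = 1.

Definition On_direction (n : nat) (u : C) : Prop :=
  direction u /\ exists o, [/\ cyclotomic_ring n o, o != 0 & parallel u o].

Definition line_parallel_to (l : set C) (u : C) : Prop :=
  exists p : C, l = [set z | exists t : R, z = p + t%:C * u].

Definition parallel_lines (l l' : set C) : Prop :=
  exists u : C, [/\ u != 0, line_parallel_to l u & line_parallel_to l' u].

(* The X-ray, a function on the lines parallel to u, is extended by 0 to all
   subsets of the plane, so that X-rays in all directions share one type. *)
Definition Xray (u : C) (F : {fset C}) (l : set C) : nat :=
  if `[< line_parallel_to l u >] then #|` [fset x in F | x \in l] | else 0%N.

Definition On_subspace1 (n : nat) (T : set C) : Prop :=
  exists o : C, [/\ cyclotomic_ring n o, o != 0
                  & T = [set z | exists t : R, z = t%:C * o]].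

Definition ortho (T : set C) : set C :=
  [set y | forall x, T x -> inner x y = 0].

(* For a linear subspace W, the orthogonal projection of x on W is the y in W
   such that x - y is orthogonal to W. *)
Definition orthogonal_projection (W : set C) (F : {fset C}) : set C :=
  [set y | W y /\ exists2 x, x \in F & ortho W (x - y)].

(* F | T^perp *)
Definition projection_perp (T : set C) (F : {fset C}) : set C :=
  orthogonal_projection (ortho T) F.

End Plane.

(* Adaptive choice of measurements: a strategy [next] maps the list of data
   observed so far to the next measurement.  The measurements chosen so far
   are themselves recovered from these data and [next], so they need not be
   recorded in the history. *)
Section Successive.
Variables (O Q D : Type) (observe : Q -> O -> D).

Fixpoint history (next : seq D -> Q) (F : O) (j : nat) : seq D :=
  if j is k.+1 then
    let h := history next F k in rcons h (observe (next h) F)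
  else [::].

(* The measurement with index j, counted from 0. *)
Definition chosen (next : seq D -> Q) (F : O) (j : nat) : Q :=
  next (history next F j).

Definition successively_determined (admissible : Q -> Prop)
    (par : Q -> Q -> Prop) (E : set O) (m : nat) : Prop :=
  exists next : seq D -> Q, forall F, E F ->
    [/\ forall j, (j < m)%N -> admissible (chosen next F j),
        forall j k, (j < k < m)%N ->
          ~ par (chosen next F j) (chosen next F k)
      & forall F', E F' ->
          (forall j, (j < m)%N ->
             observe (chosen next F j) F' = observe (chosen next F j) F) ->
          F' = F].

End Successive.

Definition succ_determined_by_Xrays (R : realType) (n : nat)
    (E : set {fset R[i]}) (m : nat) : Prop :=
  successively_determined (@Xray R) (@On_direction R n) (@parallel R) E m.

Definition succ_determined_by_projections (R : realType) (n : nat)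
    (E : set {fset R[i]}) (m : nat) : Prop :=
  successively_determined (@projection_perp R) (@On_subspace1 R n)
    (@parallel_lines R) E m.

(* Main.v *)
Require Import Defs.
From mathcomp Require Import all_boot all_order all_algebra finmap.
From mathcomp Require Import all_classical all_reals all_analysis.
From mathcomp Require Import complex ring.

(** The first direction is that of the real axis.  Seen from there, a finite
    set F of points of O_n reveals the imaginary parts of its points, hence a
    finite set of possible values for the imaginary part of a difference x - y,
    where x and y are points of O_n on the lines through F parallel to the real
    axis.  There are infinitely many candidates x, y on those lines (for most n
    they are even dense), but one second direction separates all of them: a
    vector 1 + p zeta with p a large prime.

    Suppose that x - y = t (1 + p zeta) with t real.  For z = 1 + p zeta one has
    z - z^* = p (zeta - zeta^* ) and z + z^* = 2 + p (zeta + zeta^* ), so with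
    d = x - y, eliminating t,
      2 (d - d^* ) = p ((zeta - zeta^* ) (d + d^* ) - (zeta + zeta^* ) (d - d^* )).
    The factor of p on the right is an algebraic integer.  So p divides the
    algebraic integer 2 (d - d^* ), which depends only on the imaginary part of
    d and therefore lies in a finite set known from the first observation.  A
    nonzero algebraic integer is divisible by finitely many primes only
    ([integral_not_divisible]), so for p large d - d^* = 0.  As 1 + p zeta is
    not real (here n > 2 is used), t = 0 and x = y.

    Thus every line in the second direction meets at most one of the candidate
    points ([exists_separating_vector]).  X-rays and projections both tell which
    lines in the given direction meet the set ([Xray_covered_along],
    [projection_covered_along]); this is all the argument needs, so both parts
    of the theorem follow in the same way. *)

Set Implicit Arguments.
Unset Strict Implicit.
Unset Printing Implicit Defensive.

Import Order.TTheory GRing.Theory Num.Theory.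

Local Open Scope classical_set_scope.
Local Open Scope fset_scope.
Local Open Scope complex_scope.
Local Open Scope ring_scope.

(** * Prime divisors of algebraic integers *)

(** Clearing denominators in a monic equation for v = c / p gives
    c^d = 0 modulo p. *)
Lemma prime_dvd_of_integral_quotient (K : numFieldType) (p : nat) (c : int)
    (v : K) :
  prime p -> integralOver (intr : int -> K) v -> p%:R * v = c%:~R ->
  (p%:Z %| c)%Z.
Proof.
move=> p_pr [q q_monic /eqP qv0] pv.
have [d sz_q] : exists d, size q = d.+1.
  by exists (size q).-1; rewrite prednK // lt0n size_poly_eq0 monic_neq0.
have eq0 :
    c ^+ d + p%:Z * (\sum_(i < d) q`_i * c ^+ i * p%:Z ^+ (d - i.+1)) = 0.
  apply: (@intr_inj K); rewrite rmorphD rmorphM rmorph_sum /= rmorphXn /=.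
  apply: etrans (etrans (congr1 (fun z => p%:R ^+ d * z) qv0) (mulr0 _)).
  rewrite horner_coef (size_map_inj_poly intr_inj) // sz_q.
  rewrite big_ord_recr /= mulrDr addrC !mulr_sumr; congr (_ + _).
    apply: eq_bigr => i _; rewrite coef_map /= !rmorphM !rmorphXn /= -pv.
    have -> : p%:R ^+ d = p%:R * p%:R ^+ i * p%:R ^+ (d - i.+1) :> K.
      by rewrite -exprS -exprD subnKC.
    by rewrite -pmulrn exprMn; ring.
  have -> : (map_poly intr q)`_d = 1 :> K.
    by move/monicP: q_monic; rewrite /lead_coef sz_q coef_map /= => ->.
  by rewrite -pv exprMn mul1r.
have : (p%:Z %| c ^+ d)%Z.
  by rewrite (canRL (addrK _) eq0) add0r rpredN dvdz_mulr.
by rewrite !dvdzE abszX Euclid_dvdX // => /andP[].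
Qed.

(** In a monic integer equation for y, factors X can be cancelled until the
    constant coefficient c is nonzero; the equation then reads
    c = y * (- (p - c) / X)(y). *)
Lemma integral_divides_integer (K : fieldType) (y : K) :
  y != 0 -> integralOver (intr : int -> K) y ->
  exists c : int, c != 0 /\
    exists2 w, integralOver (intr : int -> K) w & c%:~R = y * w.
Proof.
move=> y_neq0 y_int; have [p p_monic] := y_int.
elim/poly_ind: p p_monic => [|p c IHp] p_monic.
  by rewrite monicE lead_coef0 eq_sym oner_eq0 in p_monic.
rewrite rmorphD rmorphM /= map_polyX map_polyC /= rootE !hornerE => /eqP pc0.
have [c0|c_neq0] := eqVneq c 0.
  apply: IHp; first by rewrite c0 addr0 monicMr ?monicX in p_monic.
  move: pc0; rewrite c0 mulr0z addr0 => /eqP.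
  by rewrite mulf_eq0 (negPf y_neq0) orbF.
exists c; split=> //; exists (- (map_poly intr p).[y]).
  apply/integral_opp/integral_horner => //; apply/integral_poly => i.
  by rewrite coef_map; apply: integral_id.
by rewrite mulrN mulrC; apply/eqP; rewrite -addr_eq0 addrC pc0.
Qed.

(** A nonzero algebraic integer y divides a nonzero integer c, and a prime
    dividing y divides c; so every prime above all the |c| works. *)
Lemma integral_not_divisible (K : numFieldType) (s : seq K) :
    (forall y, y \in s -> integralOver (intr : int -> K) y) ->
  exists2 p : nat, prime p & forall y v, y \in s ->
    integralOver (intr : int -> K) v -> y = p%:R * v -> y = 0.
Proof.
move=> s_int.
suff [m m_bound] : exists m : nat, forall p, (m < p)%N -> prime p ->
    forall y v, y \in s -> integralOver (intr : int -> K) v ->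
      y = p%:R * v -> y = 0.
  by have [p lt_mp p_pr] := prime_above m; exists p => //; apply: m_bound.
elim: s s_int => [_|y s IHs s_int]; first by exists 0%N.
have [|m1 bound_s] := IHs.
  by move=> z z_s; apply: s_int; rewrite inE z_s orbT.
have [m2 bound_y] : exists m : nat, forall p, (m < p)%N -> prime p ->
    forall v, integralOver (intr : int -> K) v -> y = p%:R * v -> y = 0.
  have [-> | y_neq0] := eqVneq y 0; first by exists 0%N.
  have [c [c_neq0 [w w_int cE]]] : exists c : int, c != 0 /\
      exists2 w, integralOver (intr : int -> K) w & c%:~R = y * w.
    by apply: integral_divides_integer => //; apply: s_int; rewrite mem_head.
  exists `|c|%N => p lt_cp p_pr v v_int yE.
  have /(prime_dvd_of_integral_quotient p_pr) :
      integralOver (intr : int -> K) (v * w) by apply: integral_mul.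
  move=> /(_ c); rewrite mulrA -yE cE => /(_ erefl).
  rewrite dvdzE /= => /dvdn_leq.
  by rewrite absz_gt0 leqNgt lt_cp => /(_ c_neq0).
exists (maxn m1 m2) => p; rewrite gtn_max => /andP[lt1 lt2] p_pr z v.
rewrite inE => /predU1P[->|z_s]; first exact: bound_y.
exact: bound_s.
Qed.

Section Plane.
Variable R : realType.
Local Notation C := R[i].
Local Notation integral := (integralOver (intr : int -> C)).
Local Notation On n := (@cyclotomic_ring R n).

(** * Complex conjugation *)

Lemma conjc_real_mul (t : R) (z : C) : (t%:C * z)^* = t%:C * z^*.
Proof. by rewrite -[in RHS](conjc_real t) -rmorphM. Qed.

Lemma subc_conjD_real (z : C) (t : R) : (z + t%:C) - (z + t%:C)^* = z - z^*.
Proof.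
by case: z => a b; apply/eqP; rewrite eq_complex /= addr0 !subrr !eqxx.
Qed.

Lemma subc_conj_eq0 (z : C) : (z - z^* == 0) = (complex.Im z == 0).
Proof.
by case: z => a b; rewrite eq_complex /= subrr eqxx opprK -mulr2n mulrn_eq0.
Qed.

Lemma Im_real_mul (t : R) (z : C) : complex.Im (t%:C * z) = t * complex.Im z.
Proof. by case: z => a b; rewrite /= mul0r addr0. Qed.

Lemma Im_neq0_neq0 (z : C) : complex.Im z != 0 -> z != 0.
Proof. by apply: contraNneq => ->. Qed.

Lemma integral_conjc (z : C) : integral z -> integral z^*.
Proof.
case=> p p_monic pz0; exists p => //.
suff -> : map_poly intr p = map_poly (@conjc R) (map_poly intr p).
  by rewrite fmorph_root.
by rewrite -map_poly_comp; apply: eq_map_poly => m; rewrite /= rmorph_int.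
Qed.

(** * Cyclotomic integers *)

Lemma expr_cos_sin (a : R) k :
  (cos a +i* sin a) ^+ k = cos (k%:R * a) +i* sin (k%:R * a).
Proof.
elim: k => [|k IHk].
  by rewrite expr0 mul0r cos0 sin0; apply/eqP; rewrite eq_complex /= !eqxx.
rewrite exprS IHk -natr1 mulrDl mul1r addrC cosD sinD.
by apply/eqP; rewrite eq_complex /= [sin a * _ + _]addrC !eqxx.
Qed.

Lemma integral_zeta n : (0 < n)%N -> integral (zeta R n).
Proof.
move=> n_gt0; exists ('X^n - 1); first exact: monicXnsubC.
rewrite rmorphB rmorph1 /= map_polyXn rootE !hornerE subr_eq0.
rewrite expr_cos_sin mulrC divfK ?pnatr_eq0 -?lt0n //.
by rewrite -[2]/(2%:R) mulr_natl cos2pi sin2pi.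
Qed.

Lemma Im_zeta_neq0 n : (2 < n)%N -> complex.Im (zeta R n) != 0.
Proof.
move=> n_gt2; rewrite /= gt_eqF // sin_gt0_pi //.
have n_gt0 : 0 < n%:R :> R by rewrite ltr0n (ltn_trans _ n_gt2).
rewrite divr_gt0 ?mulr_gt0 ?pi_gt0 //=.
by rewrite ltr_pdivrMr // mulrC ltr_pM2l ?pi_gt0 // ltr_nat.
Qed.

Lemma cyclotomic_ring1 n : On n 1.
Proof. by exists 1; rewrite rmorph1 hornerC. Qed.

Lemma cyclotomic_ring_integral n z : (0 < n)%N -> On n z -> integral z.
Proof.
move=> n_gt0 [p ->]; apply: integral_horner (integral_zeta n_gt0).
by apply/integral_poly => i; rewrite coef_map; apply: integral_id.
Qed.

(** * The second direction *)

(** What X-rays and projections along o have in common: both determine which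
    lines of direction o meet a set, and two sets meeting the same lines are
    covered by each other in this sense. *)
Definition covered_along (o : C) (F G : {fset C}) : Prop :=
  forall x, x \in F -> exists2 y, y \in G & exists t : R, x - y = t%:C * o.

Lemma covered_along_scale (t : R) (o : C) F G :
  covered_along (t%:C * o) F G -> covered_along o F G.
Proof.
move=> FG x xF; have [y yG [s xyE]] := FG x xF; exists y => //.
by exists (s * t); rewrite xyE rmorphM mulrA.
Qed.

(** The vector is 1 + p zeta, for a prime p that divides none of the nonzero
    numbers 2 (d - d^* ), d a difference of two points of F. *)
Lemma exists_separating_vector n (F : {fset C}) :
    (2 < n)%N -> finite_subsets (On n) F ->
  exists o : C, [/\ On n o, complex.Im o != 0
    & forall F1 F2 : {fset C},
      finite_subsets (On n) F1 -> finite_subsets (On n) F2 ->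
      covered_along 1 F1 F -> covered_along 1 F2 F ->
      covered_along o F1 F2 -> {subset F1 <= F2}].
Proof.
move=> n_gt2 F_On; have n_gt0 : (0 < n)%N by apply: ltn_trans n_gt2.
have On_int := fun z => @cyclotomic_ring_integral n z n_gt0.
have zeta_int := integral_zeta n_gt0.
have skew_int z : integral z -> integral (z - z^*).
  by move=> z_int; apply: integral_sub => //; apply: integral_conjc.
have trace_int z : integral z -> integral (z + z^*).
  by move=> z_int; apply: integral_add => //; apply: integral_conjc.
pose s := [seq 2 * ((x - y) - (x - y)^*) | x <- F, y <- F].
have [|p p_pr p_ndvd] := @integral_not_divisible C s.
  move=> _ /allpairsP[[x y] /= [xF yF ->]]; apply: integral_mul.
    exact: integral_nat.
  by apply/skew_int/integral_sub; apply: On_int; apply: F_On.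
have p_neq0 : p%:R != 0 :> R by rewrite pnatr_eq0 -lt0n prime_gt0.
pose o : C := 1 + p%:R * zeta R n.
have oJ : o^* = 1 + p%:R * (zeta R n)^*.
  by rewrite rmorphD rmorphM rmorph1 rmorph_nat.
have Im_o : complex.Im o = p%:R * complex.Im (zeta R n).
  by rewrite /o -(rmorph_nat (real_complex R)) /= mul0r addr0 add0r.
have Im_o_neq0 : complex.Im o != 0 by rewrite Im_o mulf_neq0 ?Im_zeta_neq0.
exists o; split=> //.
  exists (1 + 'X *+ p).
  rewrite rmorphD rmorphMn rmorph1 /= map_polyX !hornerE /o mulr_natl.
  by rewrite hornerMn hornerX.
move=> F1 F2 F1_On F2_On F1_F F2_F F12 x xF1.
have [y yF2 [t xyE]] := F12 x xF1; suff -> : x = y by [].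
have [x' x'F [a xE]] := F1_F x xF1; have [y' y'F [b yE]] := F2_F y yF2.
have d_int : integral (x - y).
  by apply: integral_sub; apply: On_int; [apply: F1_On | apply: F2_On].
(* x and y lie on the horizontal lines through the points x' and y' of F. *)
have skewE : (x - y) - (x - y)^* = (x' - y') - (x' - y')^*.
  have -> : x - y = x' - y' + (a - b)%:C.
    by rewrite rmorphB /= -[a%:C]mulr1 -[b%:C]mulr1 -xE -yE; ring.
  exact: subc_conjD_real.
have skew0 : 2 * ((x - y) - (x - y)^*) = 0.
  apply: (p_ndvd _ ((zeta R n - (zeta R n)^*) * ((x - y) + (x - y)^*)
                    - (zeta R n + (zeta R n)^*) * ((x - y) - (x - y)^*))).
  - by rewrite skewE; apply/allpairsP; exists (x', y').
  - by apply: integral_sub; apply: integral_mul; auto.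
  - by rewrite xyE conjc_real_mul oJ /o; ring.
move/eqP: skew0; rewrite mulf_eq0 pnatr_eq0 /= xyE conjc_real_mul -mulrBr.
rewrite mulf_eq0 subc_conj_eq0 (negPf Im_o_neq0) orbF => /eqP t0.
by apply/eqP; rewrite -subr_eq0 xyE t0 mul0r.
Qed.

Lemma separating_vector_determines n (F : {fset C}) :
    (2 < n)%N -> finite_subsets (On n) F ->
  exists o : C, [/\ On n o, complex.Im o != 0
    & forall F1 F2 : {fset C},
      finite_subsets (On n) F1 -> finite_subsets (On n) F2 ->
      covered_along 1 F1 F -> covered_along 1 F2 F ->
      covered_along o F1 F2 -> covered_along o F2 F1 -> F1 = F2].
Proof.
move=> n_gt2 F_On.
have [ o [oP Im_o sep]] := exists_separating_vector n_gt2 F_On.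
exists o; split=> // F1 F2 F1_On F2_On F1_F F2_F F12 F21.
by apply/fsetP => x; apply/idP/idP; apply: sep.
Qed.

(** * X-rays and projections *)

Lemma Xray_covered_along (u : C) F G :
  Xray u F = Xray u G -> covered_along u F G.
Proof.
move=> FG x xF; pose l := [set z : C | exists t : R, z = x + t%:C * u]%classic.
have l_par : line_parallel_to l u by exists x.
have := congr1 (@^~ l) FG; rewrite /Xray asboolT // => card_eq.
have : (0 < #|` [fset y in G | y \in l]|)%N.
  rewrite -card_eq cardfs_gt0; apply/fset0Pn; exists x.
  by rewrite !inE xF /=; apply/mem_set; exists 0; rewrite mul0r addr0.
rewrite cardfs_gt0 => /fset0Pn[y]; rewrite !inE /= => /andP[yG /set_mem[t yE]].
by exists y => //; exists (- t); rewrite yE rmorphN /=; ring.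
Qed.

Definition real_span (o : C) : set C :=
  [set z | exists t : R, z = t%:C * o]%classic.

Lemma real_span_not_parallel (o : C) :
  complex.Im o != 0 -> ~ parallel_lines (real_span 1) (real_span o).
Proof.
move=> Im_o [u [_ [p T0E] [q TE]]].
have inT0 (a : R) : exists s : R, a%:C = p + s%:C * u.
  have : real_span 1 a%:C by exists a; rewrite mulr1.
  by rewrite T0E.
have inT (a : R) : exists s : R, a%:C * o = q + s%:C * u.
  have : real_span o (a%:C * o) by exists a.
  by rewrite TE.
have [[r0 p0] [r1 p1]] := (inT0 0, inT0 1).
have [[s0 q0] [s1 q1]] := (inT 0, inT 1).
(* As differences of points of the two lines, 1 and o are both multiples of
   u; the first makes u real, the second then makes o real. *)
have uE : 1 = (r1 - r0)%:C * u.
  by rewrite rmorphB mulrBl -[LHS]subr0 [X in X - _]p1 [X in _ - X]p0; ring.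
have oE : o = (s1 - s0)%:C * u.
  rewrite rmorphB mulrBl -[LHS]mul1r -[LHS]subr0 [X in X - _]q1.
  by rewrite -[X in _ - X](mul0r o) [X in _ - X]q0; ring.
have Im_u : (r1 - r0) * complex.Im u = 0 by rewrite -Im_real_mul -uE.
move: Im_o; rewrite oE Im_real_mul mulf_eq0 negb_or => /andP[_ /negP[]].
move/eqP: Im_u; rewrite mulf_eq0 => /orP[/eqP r0E|//].
by move: uE; rewrite r0E mul0r => /eqP; rewrite oner_eq0.
Qed.

(** For o = a + ib, orthogonality to the vector - b + ia, itself orthogonal to
    o, already forces z to be a real multiple of o. *)
Lemma ortho_ortho_real_span (o z : C) : o != 0 ->
  Defs.ortho (Defs.ortho (real_span o)) z <-> real_span o z.
Proof.
case: o z => a b [z1 z2] o_neq0; split=> [z_ortho | zT w]; last first.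
  by move=> /(_ _ zT); rewrite /inner mulrC [X in _ + X]mulrC.
have n_neq0 : a ^+ 2 + b ^+ 2 != 0.
  by move: o_neq0; rewrite eq_complex /= paddr_eq0 ?sqr_ge0 // !sqrf_eq0.
have /z_ortho : Defs.ortho (real_span (a +i* b)) (- b +i* a).
  by move=> _ [t ->]; rewrite /inner /=; ring.
rewrite /inner /= => z_perp.
exists ((a * z1 + b * z2) / (a ^+ 2 + b ^+ 2)).
apply/eqP; rewrite eq_complex /= !mul0r subr0 addr0.
apply/andP; split; apply/eqP/(mulIf n_neq0).
  transitivity ((a * z1 + b * z2) * a - b * (- b * z1 + a * z2)); first by ring.
  by rewrite z_perp; field.
transitivity ((a * z1 + b * z2) * b + a * (- b * z1 + a * z2)); first by ring.
by rewrite z_perp; field.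
Qed.

Lemma orthogonal_decomposition (o x : C) : o != 0 ->
  exists2 y, Defs.ortho (real_span o) y & real_span o (x - y).
Proof.
case: o x => a b [x1 x2] o_neq0.
have n_neq0 : a ^+ 2 + b ^+ 2 != 0.
  by move: o_neq0; rewrite eq_complex /= paddr_eq0 ?sqr_ge0 // !sqrf_eq0.
pose c := (x1 * a + x2 * b) / (a ^+ 2 + b ^+ 2).
exists ((x1 +i* x2) - c%:C * (a +i* b)); last first.
  by exists c; rewrite subKr.
by move=> _ [t ->]; rewrite /inner /= /c; field.
Qed.

Lemma projection_covered_along (o : C) F G : o != 0 ->
  projection_perp (real_span o) F = projection_perp (real_span o) G ->
  covered_along o F G.
Proof.
move=> o_neq0 FG x xF.
have [y y_perp xyT] := orthogonal_decomposition x o_neq0.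
have : projection_perp (real_span o) F y.
  by split=> //; exists x => //; apply/ortho_ortho_real_span.
rewrite FG => -[_ [z zG /ortho_ortho_real_span -/(_ o_neq0)[t zyE]]].
case: xyT => s xyE; exists z => //; exists (s - t).
by rewrite rmorphB mulrBl -xyE -zyE; ring.
Qed.

Lemma exists_normalizing_factor (o : C) :
  o != 0 -> exists2 t : R, t != 0 & `|t%:C * o| = 1.
Proof.
rewrite -normr_gt0 normc_def ltcR => s_gt0.
exists (Num.sqrt (complex.Re o ^+ 2 + complex.Im o ^+ 2))^-1.
  by rewrite invr_neq0 ?gt_eqF.
rewrite normrM [X in X * _]normc_def [X in _ * X]normc_def /= expr0n addr0.
by rewrite sqrtr_sqr -rmorphM /= normfV gtr0_norm // mulVf ?gt_eqF.
Qed.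

End Plane.

(** * Adaptive measurements *)

(** A fixed first query q0 and, for each first answer, a second query that
    tells apart all objects with that first answer make a strategy: the second
    query is chosen, by the axiom of choice, as a function of the answer. *)
Lemma successively_determined_two (O Q D : Type) (observe : Q -> O -> D)
    (admissible : Q -> Prop) (par : Q -> Q -> Prop) (E : set O) (q0 : Q) :
  admissible q0 ->
  (forall F, E F -> exists q, [/\ admissible q, ~ par q0 q
     & forall F1 F2, E F1 -> E F2 ->
         observe q0 F1 = observe q0 F -> observe q0 F2 = observe q0 F ->
         observe q F1 = observe q F2 -> F1 = F2]) ->
  successively_determined observe admissible par E 2.
Proof.
move=> q0_adm ex_q.
pose good d q := [/\ admissible q, ~ par q0 q
  & forall F1 F2, E F1 -> E F2 -> observe q0 F1 = d -> observe q0 F2 = d ->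
         observe q F1 = observe q F2 -> F1 = F2].
(* Answers that come from no object of E get the arbitrary query q0. *)
pose second d :=
  if pselect (exists q, good d q) is left ex then sval (cid ex) else q0.
pose next h := if h is d :: _ then second d else q0.
exists next => F EF.
have [q_adm q_npar q_det] : good (observe q0 F) (second (observe q0 F)).
  rewrite /second; case: pselect => [ex|[]]; last exact: ex_q.
  exact: (svalP (cid ex)).
split=> [[|[|//]] // | j [|[|k]] /andP[] // | F' EF' obs_eq].
  by case: j.
by apply: q_det => //; [exact: (obs_eq 0%N)|exact: (obs_eq 1%N)].
Qed.

Lemma Xrays_determine (R : realType) n : (2 < n)%N ->
  succ_determined_by_Xrays n (finite_subsets (@cyclotomic_ring R n)) 2.
Proof.
move=> n_gt2; apply: (@successively_determined_two _ _ _ _ _ _ _ 1).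
  split; first exact: normr1.
  exists 1; split; [exact: cyclotomic_ring1 | exact: oner_neq0|].
  by exists 1; rewrite ?oner_neq0 ?mulr1.
move=> F F_On.
have [ o [oP Im_o det]] := separating_vector_determines n_gt2 F_On.
have o_neq0 := Im_neq0_neq0 Im_o.
have [t t_neq0 u_norm] := exists_normalizing_factor o_neq0.
exists (t%:C * o); split.
- by split=> //; exists o; split=> //; exists t.
- case=> s s_neq0 /(congr1 (@complex.Im R))/esym/eqP.
  by rewrite !Im_real_mul !mulf_eq0 (negPf s_neq0) (negPf t_neq0) (negPf Im_o).
move=> F1 F2 F1_On F2_On /Xray_covered_along F1_F /Xray_covered_along F2_F F12.
by apply: det => //; apply: (@covered_along_scale _ t);
  apply: Xray_covered_along.
Qed.

Lemma projections_determine (R : realType) n : (2 < n)%N ->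
  succ_determined_by_projections n (finite_subsets (@cyclotomic_ring R n)) 2.
Proof.
move=> n_gt2.
apply: (@successively_determined_two _ _ _ _ _ _ _ (@real_span R 1)).
  by exists 1; split; [exact: cyclotomic_ring1 | exact: oner_neq0|].
move=> F F_On.
have [ o [oP Im_o det]] := separating_vector_determines n_gt2 F_On.
have o_neq0 := Im_neq0_neq0 Im_o.
exists (real_span o); split; first by exists o.
  exact: real_span_not_parallel.
have one_neq0 : 1 != 0 :> R[i] := oner_neq0 _.
move=> F1 F2 F1_On F2_On /(projection_covered_along one_neq0) F1_F.
move=> /(projection_covered_along one_neq0) F2_F F12.
by apply: det => //; apply: projection_covered_along.
Qed.

Theorem theorem20 (R : realType) (n : nat) (hn : (2 < n)%N) :
  succ_determined_by_Xrays n (finite_subsets (@cyclotomic_ring R n)) 2 /\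
  succ_determined_by_projections n (finite_subsets (@cyclotomic_ring R n)) 2.
Proof. by split; [apply: Xrays_determine | apply: projections_determine]. Qed.
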